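(* Let $\{X_n\}_{n=1}^{\infty}$ be a sequence of pairwise independent identically distributed real-valued random variables on a probability space, and let $S_n=\sum_{k=1}^{n}X_k$ for $n\geqslant 1$. Let $1<p<2$. If $E|X_1|^p<\infty$, then $$\frac{S_n-ES_n}{n^{1/p}}\to 0 \quad\text{almost surely as } n\to\infty.$$
   Context: Pairwise independent means that $X_i$ and $X_j$ are independent for all $i\neq j$ (joint independence of the whole sequence is not assumed). $E$ denotes expectation. *)

(* Defs.v *)
From HB Require Import structures.
From mathcomp Require Import all_boot all_order all_algebra.
From mathcomp Require Import all_classical all_reals all_analysis.

Set Implicit Arguments.
Unset Strict Implicit.
Unset Printing Implicit Defensive.

Import Order.TTheory GRing.Theory Num.Theory.
Import numFieldNormedType.Exports.

Local Open Scope classical_set_scope.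
Local Open Scope ring_scope.

Definition independent_rv (d : measure_display) (T : measurableType d)
    (R : realType) (P : probability T R) (X Y : {RV P >-> R}) : Prop :=
  forall A B : set R, measurable A -> measurable B ->
    P (X @^-1` A `&` Y @^-1` B) = (P (X @^-1` A) * P (Y @^-1` B))%E.

Definition pairwise_independent (d : measure_display) (T : measurableType d)
    (R : realType) (P : probability T R) (X : nat -> {RV P >-> R}) : Prop :=
  forall i j : nat, i != j -> independent_rv (X i) (X j).

(* The laws are compared on Borel sets only: the library's measures are total
   functions on [set R], with unspecified values on non-measurable sets. *)
Definition identically_distributed (d : measure_display)
    (T : measurableType d) (R : realType) (P : probability T R)
    (X : nat -> {RV P >-> R}) : Prop :=
  forall (i j : nat) (A : set R), measurable A ->
    distribution P (X i) A = distribution P (X j) A.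

(* Sequences are indexed from 0: [X k] stands for the variable X_{k+1}, so
   that [partial_sum X n] is S_n = X_1 + ... + X_n. *)
Definition partial_sum (d : measure_display) (T : measurableType d)
    (R : realType) (P : probability T R) (X : nat -> {RV P >-> R})
    (n : nat) : T -> R :=
  fun w => \sum_(k < n) X k w.

(* Main.v *)
Require Import Defs.
From HB Require Import structures.
From mathcomp Require Import all_boot all_order all_algebra.
From mathcomp Require Import all_classical all_reals all_analysis.
From mathcomp Require Import measurable_realfun.
From mathcomp Require Import zify ring lra.

Set Implicit Arguments.
Unset Strict Implicit.
Unset Printing Implicit Defensive.

Import Order.TTheory GRing.Theory Num.Theory.
Import numFieldNormedType.Exports.

Local Open Scope classical_set_scope.
Local Open Scope ring_scope.

(* Rio's dyadic argument.  Splitting into positive and negative parts, let the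
   variables be nonnegative, put b = 2 ^ (1/p), and truncate at b ^ m the
   variables entering a dyadic block of length 2 ^ m, so that the truncation
   level follows the block length.  Since the truncations increase with m, the
   prefix sums inside a block of length 2 ^ n are controlled by the centred
   block sums D_{m,k} of all levels m <= n plus a deterministic error.  Pairwise
   independence gives Var D_{m,k} <= 2 ^ m E[(X /\ b ^ m) ^ 2], and E X ^ p < oo
   makes a suitably weighted sum of all the D_{m,k} ^ 2 integrable; hence it is
   finite almost surely and its terms tend to 0.  The truncation error divided
   by b ^ n is summable in mean, hence also negligible almost surely. *)

(** * Geometric sums and convolutions with a geometric kernel *)

Lemma sum_geom_le (R : realFieldType) (a : R) (n : nat) : 0 <= a < 1 ->
  \sum_(i < n) a ^+ i <= (1 - a)^-1.
Proof.
move=> /andP[a0 a1]; have a1' : 0 < 1 - a by rewrite subr_gt0.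
have := subrX1 a n; have := exprn_ge0 n a0.
set s := \sum_(i < n) _ => an0 e.
by rewrite -(ler_pM2l a1') divff ?gt_eqF//; nra.
Qed.

Lemma sum_geom_le_gt1 (R : realFieldType) (a : R) (n : nat) : 1 < a ->
  \sum_(i < n) a ^+ i <= a ^+ n / (a - 1).
Proof.
move=> a1; have a1' : 0 < a - 1 by rewrite subr_gt0.
by rewrite ler_pdivlMr// mulrC -subrX1; lra.
Qed.

(** Young's inequality for a geometric kernel, whose total mass is 1 / (1 - a). The induction rests
    on [SE]: one more outer index multiplies the double sum by [a] and adds the plain sum of [b],
    and the claimed bound is stable under this operation. *)
Lemma sum_conv_le (R : realFieldType) (a : R) (b : nat -> R) (N : nat) :
  0 <= a < 1 -> (forall n, 0 <= b n) ->
  \sum_(n < N) \sum_(l < n.+1) a ^+ (n - l) * b l <=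
  (\sum_(l < N) b l) / (1 - a).
Proof.
move=> /andP[a0 a1] b0; have a1' : 0 < 1 - a by rewrite subr_gt0.
set S := fun N => \sum_(n < N) \sum_(l < n.+1) a ^+ (n - l) * b l.
have SE n : S n.+1 = a * S n + \sum_(l < n.+1) b l.
  elim: n => [|n IHn].
    by rewrite /S !big_ord_recl !big_ord0 /= subnn expr0; lra.
  have e : \sum_(l < n.+1) a ^+ (n.+1 - l) * b l =
      a * \sum_(l < n.+1) a ^+ (n - l) * b l.
    rewrite mulr_sumr; apply: eq_bigr => i _.
    by rewrite mulrA -exprS subSn// -ltnS.
  have SS m : S m.+1 = S m + \sum_(l < m.+1) a ^+ (m - l) * b l.
    by rewrite /S big_ord_recr.
  rewrite SS {1}IHn SS [X in _ + X = _]big_ord_recr/= e subnn expr0 mul1r.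
  by rewrite [X in _ = _ + X]big_ord_recr/=; ring.
rewrite -/(S N); elim: N => [|N IH].
  by rewrite /S !big_ord0 mul0r.
rewrite SE.
have le1 : S N <= (\sum_(l < N.+1) b l) / (1 - a).
  apply: (le_trans IH); rewrite ler_pM2r ?invr_gt0//.
  by rewrite big_ord_recr /= lerDl.
rewrite ler_pdivlMr//; rewrite ler_pdivlMr// in le1.
nra.
Qed.

Lemma bounded_partial_sum_cvg0 (R : realType) (u : R^nat) (C : R) :
  (forall n, 0 <= u n) -> (forall N, \sum_(n < N) u n <= C) ->
  u n @[n --> \oo] --> (0 : R).
Proof.
move=> u0 uC; apply: cvg_series_cvg_0.
apply: nondecreasing_is_cvgn.
  apply/nondecreasing_seqP => n; rewrite /series /=.
  by rewrite big_nat_recr//= lerDl.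
by exists C => _ [n _ <-]; rewrite /series /= big_mkord.
Qed.

Lemma cvg_conv_geom (R : realType) (a : R) (b : R^nat) (C : R) :
  0 <= a < 1 -> (forall n, 0 <= b n) -> (forall N, \sum_(n < N) b n <= C) ->
  \sum_(l < n.+1) a ^+ (n - l) * b l @[n --> \oo] --> (0 : R).
Proof.
move=> a01 b0 bC.
apply: (@bounded_partial_sum_cvg0 _ _ (C / (1 - a))) => [n|N].
  by apply: sumr_ge0 => i _; rewrite mulr_ge0// exprn_ge0//; case/andP: a01.
apply: (le_trans (sum_conv_le N a01 b0)); rewrite ler_pM2r//.
by rewrite invr_gt0 subr_gt0; case/andP: a01.
Qed.

(** * Deterministic control of prefix sums by dyadic block sums *)

(* Passing from level [m] to [m.+1] changes the prefix sum by the centred sum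
   of the nonnegative increments [y m.+1 i - y m i], which lies between minus
   its mean and the increment sum over the whole block; the latter is a
   combination of the full block sums at levels [m] and [m.+1]. *)
Lemma dyadic_prefix_bound (R : realFieldType) (y : nat -> nat -> R)
    (mu d : nat -> R) (n : nat) :
  (forall m i, y m i <= y m.+1 i) -> (forall m, mu m <= mu m.+1) ->
  (forall m k, (m <= n)%N -> (k.+1 * 2 ^ m <= 2 ^ n)%N ->
    `|\sum_(i < 2 ^ m) (y m (k * 2 ^ m + i)%N - mu m)| <= d m) ->
  forall m k j, (m <= n)%N -> (k.+1 * 2 ^ m <= 2 ^ n)%N -> (j <= 2 ^ m)%N ->
  `|\sum_(i < j) (y m (k * 2 ^ m + i)%N - mu m)| <=
  4 * (\sum_(l < m) d l) + d m + \sum_(l < m) 2 ^+ l.+1 * (mu l.+1 - mu l).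
Proof.
move=> ymono mumono Hd; elim=> [|m IH] k j mn kn.
  rewrite expn0 !big_ord0 mulr0 add0r addr0.
  have dk := Hd 0%N k mn kn.
  case: j => [|[|//]] _; last exact: dk.
  by rewrite big_ord0 normr0; apply: le_trans dk.
have pow2 : (2 ^ m.+1 = 2 ^ m + 2 ^ m)%N by rewrite expnS mul2n addnn.
(* Block [k] of level [m.+1] consists of the blocks [k.*2] and [k.*2.+1] of level [m]. *)
have kn0 : ((k.*2).+1 * 2 ^ m <= 2 ^ n)%N.
  by apply: leq_trans kn; rewrite pow2 -muln2 !mulSn mulnDr; lia.
have kn1 : ((k.*2.+1).+1 * 2 ^ m <= 2 ^ n)%N.
  by apply: leq_trans kn; rewrite pow2 -muln2 !mulSn mulnDr; lia.
have mn' : (m <= n)%N by exact: ltnW.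
have e0 i : (k.*2 * 2 ^ m + i = k * 2 ^ m.+1 + i)%N.
  by rewrite pow2 -muln2; lia.
have e1 i : (k.*2.+1 * 2 ^ m + i = k * 2 ^ m.+1 + (2 ^ m + i))%N.
  by rewrite pow2 -muln2; lia.
pose z l i : R := y l (k * 2 ^ m.+1 + i)%N.
have D0 := Hd m k.*2 mn' kn0; have D1 := Hd m k.*2.+1 mn' kn1.
have D2 := Hd m.+1 k mn kn.
rewrite (eq_bigr (fun i : 'I_(2 ^ m) => z m i - mu m)) in D0; last first.
  by move=> i _; rewrite e0.
rewrite (eq_bigr (fun i : 'I_(2 ^ m) => z m (2 ^ m + i)%N - mu m)) in D1;
  last by move=> i _; rewrite e1.
set B := 4 * _ + _ + _ in IH.
rewrite !big_ord_recr /=.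
set M := 2 ^+ m.+1 * (mu m.+1 - mu m).
(* The first bound costs one [d m], for the full left half when the prefix reaches into the right
   half; the second costs two, one for each half. With the [d m] already in [B] this gives the
   coefficient 4 at level [m]. *)
suff H j' : (j' <= 2 ^ m.+1)%N ->
    `|\sum_(i < j') (z m i - mu m)| <= B + d m /\
    `|\sum_(i < j') ((z m.+1 i - z m i) - (mu m.+1 - mu m))|
       <= 2 * d m + d m.+1 + M.
  move=> /H[H1 H2]; rewrite (eq_bigr (fun i : 'I_j => (z m i - mu m) +
      ((z m.+1 i - z m i) - (mu m.+1 - mu m)))); last first.
    by move=> i _; rewrite /z; ring.
  rewrite big_split /=; apply: (le_trans (ler_normD _ _)).
  by apply: (le_trans (lerD H1 H2)); rewrite /B; lra.
have dm0 : 0 <= d m by apply: le_trans D0.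
have dm1 : 0 <= d m.+1 by apply: le_trans D2.
move=> jm; split.
  case: (leqP j' (2 ^ m)) => jm'.
    have := IH k.*2 j' mn' kn0 jm'.
    rewrite (eq_bigr (fun i : 'I_j' => z m i - mu m)); last first.
      by move=> i _; rewrite e0.
    by move=> /le_trans; apply; rewrite lerDl.
  have -> : j' = (2 ^ m + (j' - 2 ^ m))%N by rewrite subnKC// ltnW.
  rewrite big_split_ord /=; apply: (le_trans (ler_normD _ _)).
  rewrite addrC; apply: lerD => //.
  have jm2 : (j' - 2 ^ m <= 2 ^ m)%N by rewrite leq_subLR -pow2.
  have := IH k.*2.+1 _ mn' kn1 jm2.
  by rewrite (eq_bigr (fun i : 'I_(j' - 2 ^ m) => z m (2 ^ m + i)%N - mu m))
    => // i _; rewrite e1.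
have Mp l : \sum_(i < l) (mu m.+1 - mu m) = l%:R * (mu m.+1 - mu m).
  by rewrite sumr_const card_ord -[LHS]mulr_natl.
have Mge : 0 <= mu m.+1 - mu m by rewrite subr_ge0.
have zge i : 0 <= z m.+1 i - z m i by rewrite subr_ge0 ymono.
have full : \sum_(i < 2 ^ m.+1) (z m.+1 i - z m i) <= 2 * d m + d m.+1 + M.
  have E : \sum_(i < 2 ^ m.+1) (z m.+1 i - z m i) =
      \sum_(i < 2 ^ m.+1) (z m.+1 i - mu m.+1)
      - (\sum_(i < 2 ^ m) (z m i - mu m) +
         \sum_(i < 2 ^ m) (z m (2 ^ m + i)%N - mu m)) + M.
    have -> : \sum_(i < 2 ^ m) (z m i - mu m) +
         \sum_(i < 2 ^ m) (z m (2 ^ m + i)%N - mu m) =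
        \sum_(i < 2 ^ m.+1) (z m i - mu m).
      by rewrite pow2 big_split_ord.
    have -> : M = \sum_(i < 2 ^ m.+1) (mu m.+1 - mu m).
      by rewrite Mp natrX.
    by rewrite -sumrB -big_split /=; apply: eq_bigr => i _; ring.
  have D2' : `|\sum_(i < 2 ^ m.+1) (z m.+1 i - mu m.+1)| <= d m.+1 by [].
  move: D0 D1 D2'; rewrite E !ler_norml.
  by move=> /andP[? ?] /andP[? ?] /andP[? ?]; lra.
have part : 0 <= \sum_(i < j') (z m.+1 i - z m i)
                <= \sum_(i < 2 ^ m.+1) (z m.+1 i - z m i).
  rewrite sumr_ge0 //=; rewrite -(subnKC jm) big_split_ord /= lerDl.
  by apply: sumr_ge0.
have Mj : 0 <= \sum_(i < j') (mu m.+1 - mu m) <= M.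
  by rewrite Mp mulr_ge0//= /M -natrX ler_wpM2r// ler_nat.
rewrite sumrB ler_norml; move: part Mj => /andP[? ?] /andP[? ?].
by apply/andP; split; lra.
Qed.

(** * Pointwise bounds for the truncation series *)

Lemma exists_expr_ge (R : realType) (b x : R) : 1 < b -> exists n, x <= b ^+ n.
Proof.
move=> b1; have b1' : 0 < b - 1 by rewrite subr_gt0.
exists (Num.truncn (x / (b - 1))).+1.
set n := _.+1.
have xn : x <= n%:R * (b - 1).
  by rewrite -ler_pdivrMr// ltW// truncnS_gt.
have bern k : 1 + k%:R * (b - 1) <= b ^+ k.
  elim: k => [|k IH]; first by rewrite mul0r addr0 expr0.
  rewrite exprS -[k.+1]addn1 natrD.
  have bIH : b * (1 + k%:R * (b - 1)) <= b * b ^+ k by rewrite ler_wpM2l//; lra.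
  by have := mulr_ge0 (ler0n R k) (sqr_ge0 (b - 1)); lra.
by apply: le_trans (bern n); lra.
Qed.

(* The index [m], least with [x <= b ^+ m], is where both truncation series
   below switch from geometric growth to decay. *)
Lemma exists_scale (R : realType) (b p x : R) : 1 < b -> 0 < p -> b `^ p = 2 ->
  exists m, [/\ x <= b ^+ m, (forall i, (i < m)%N -> b ^+ i < x) &
                2 ^+ m <= 1 + 2 * x `^ p].
Proof.
move=> b1 p0 bp; have := exists_expr_ge x b1; set Q := fun n => x <= b ^+ n.
move=> exQ; have [m Qm mmin] := @ex_minnP Q exQ.
have lt_m i : (i < m)%N -> b ^+ i < x.
  by move=> im; rewrite ltNge; apply/negP => /mmin; rewrite leqNgt im.
exists m; split => //.
(* For [m = 0] the summand 1 suffices. Otherwise the preceding power of [b] lies below [x], and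
   raising to the power [p] turns powers of [b] into powers of 2. *)
case: m {Qm mmin} lt_m => [_|m lt_m].
  by rewrite expr0 lerDl mulr_ge0// powR_ge0.
have bx := lt_m m (ltnSn m).
have b0 : 0 <= b ^+ m by rewrite exprn_ge0//; lra.
have <- : (b ^+ m.+1) `^ p = 2 ^+ m.+1.
  rewrite -powR_mulrn; last lra.
  by rewrite powRAC bp powR_mulrn.
rewrite exprS powRM//; last lra.
rewrite bp.
have le : (b ^+ m) `^ p <= x `^ p.
  by apply: ge0_ler_powR; rewrite ?nnegrE; lra.
lra.
Qed.

(** Overshooting to [m + N] terms spares a comparison of [m] with [N]. *)
Lemma sum_widen_le (R : realFieldType) (u : nat -> R) (m N : nat) :
  (forall n, 0 <= u n) ->
  \sum_(i < N) u i <= \sum_(i < m) u i + \sum_(i < N) u (m + i)%N.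
Proof.
move=> u0.
have <- : \sum_(i < m + N) u i = \sum_(i < m) u i + \sum_(i < N) u (m + i)%N.
  by rewrite big_split_ord.
by rewrite addnC big_split_ord /= lerDl sumr_ge0.
Qed.

(** With [m] from [exists_scale] and q = 2 / b ^ 2, the terms of index i < m are at most q ^ i * b ^
    (2 i) = 2 ^ i. From [m] on, the minimum is at most b ^ m, so the terms are dominated by 2 ^ m
    times a geometric sequence of ratio q < 1. Both pieces are of order 2 ^ m, hence of order 1 + x
    ^ p. *)
Lemma sum_trunc_sq_le (R : realType) (b p x : R) (N : nat) :
  1 < b -> 2 < b ^+ 2 -> 0 < p -> b `^ p = 2 -> 0 <= x ->
  \sum_(m < N) (2 / b ^+ 2) ^+ m * (Num.min x (b ^+ m)) ^+ 2 <=
  (1 + (1 - 2 / b ^+ 2)^-1) * (1 + 2 * x `^ p).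
Proof.
move=> b1 b2 p0 bp x0; have [m [xm lt_m mle]] := exists_scale x b1 p0 bp.
set q := 2 / b ^+ 2.
have b0 : 0 < b by lra.
have q0 : 0 < q by rewrite divr_gt0// exprn_gt0.
have q1 : q < 1 by rewrite ltr_pdivrMr ?exprn_gt0// mul1r.
have qb i : q ^+ i * (b ^+ i) ^+ 2 = 2 ^+ i.
  by rewrite exprAC -exprMn divfK// gt_eqF ?exprn_gt0.
have minge0 i : 0 <= Num.min x (b ^+ i) by rewrite le_min x0 exprn_ge0// ltW.
have t0 n : 0 <= q ^+ n * Num.min x (b ^+ n) ^+ 2.
  by rewrite mulr_ge0 ?sqr_ge0 ?exprn_ge0// ltW.
apply: (le_trans (sum_widen_le m N t0)).
have s1 : \sum_(i < m) q ^+ i * Num.min x (b ^+ i) ^+ 2 <= 2 ^+ m.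
  apply: le_trans (_ : \sum_(i < m) 2 ^+ i <= _); last first.
    have := @sum_geom_le_gt1 R 2 m; rewrite (_ : 2 - 1 = 1) ?divr1; last lra.
    by apply; lra.
  apply: ler_sum => i _; rewrite -qb ler_wpM2l ?exprn_ge0 ?(ltW q0)//.
  by rewrite lerXn2r ?nnegrE ?exprn_ge0 ?(ltW b0)// ge_min lexx orbT.
have s2 : \sum_(i < N) q ^+ (m + i) * Num.min x (b ^+ (m + i)) ^+ 2 <=
    2 ^+ m * (1 - q)^-1.
  apply: le_trans (_ : 2 ^+ m * \sum_(i < N) q ^+ i <= _); last first.
    by rewrite ler_wpM2l ?exprn_ge0// sum_geom_le// q1 ltW.
  rewrite mulr_sumr; apply: ler_sum => i _.
  rewrite exprD -[q ^+ m * _]mulrC -mulrA mulrC.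
  rewrite ler_wpM2r ?exprn_ge0 ?(ltW q0)//.
  rewrite -qb ler_wpM2l ?exprn_ge0 ?(ltW q0)//.
  by rewrite lerXn2r ?nnegrE ?exprn_ge0 ?(ltW b0)// ge_min xm.
apply: (le_trans (lerD s1 s2)); rewrite -[X in X + _]mulr1 -mulrDr mulrC.
by rewrite ler_wpM2l// addr_ge0// invr_ge0 subr_ge0 ltW.
Qed.

(** The excess vanishes from the scale [m] on. Below it the excess is at most b ^ m, while the
    weights grow geometrically, so the sum is of order (2 / b) ^ m * b ^ m = 2 ^ m. *)
Lemma sum_trunc_excess_le (R : realType) (b p x : R) (N : nat) :
  1 < b -> b < 2 -> 0 < p -> b `^ p = 2 -> 0 <= x ->
  \sum_(m < N) (2 / b) ^+ m * (x - Num.min x (b ^+ m)) <=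
  (2 / b - 1)^-1 * (1 + 2 * x `^ p).
Proof.
move=> b1 b2 p0 bp x0; have [m [xm lt_m mle]] := exists_scale x b1 p0 bp.
set c := 2 / b.
have b0 : 0 < b by lra.
have c1 : 1 < c by rewrite ltr_pdivlMr// mul1r.
have c0 : 0 <= c by lra.
have t0 n : 0 <= c ^+ n * (x - Num.min x (b ^+ n)).
  by rewrite mulr_ge0 ?exprn_ge0// subr_ge0 ge_min lexx.
apply: (le_trans (sum_widen_le m N t0)).
rewrite [X in _ + X]big1 ?addr0; last first.
  move=> i _; rewrite (min_idPl _) ?subrr ?mulr0//.
  rewrite exprD; apply: (le_trans xm).
  by rewrite ler_peMr ?exprn_ge0 ?exprn_ege1 ?(ltW b0) ?(ltW b1).
apply: (@le_trans _ _ ((\sum_(i < m) c ^+ i) * b ^+ m)).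
  rewrite mulr_suml; apply: ler_sum => i _; rewrite ler_wpM2l ?exprn_ge0//.
  rewrite lerBlDr; apply: (le_trans xm).
  by rewrite lerDl le_min x0 exprn_ge0// ltW.
apply: (@le_trans _ _ (c ^+ m / (c - 1) * b ^+ m)).
  by rewrite ler_wpM2r ?exprn_ge0 ?sum_geom_le_gt1// ltW.
rewrite mulrAC -exprMn divfK ?gt_eqF// mulrC ler_wpM2l// invr_ge0.
by rewrite subr_ge0 ltW.
Qed.

(** * From block bounds to convergence along one sample path *)

(** In the application [x i] is the value at a fixed sample point, [y m i] its truncation at level
    [m], and [mean] and [mu m] are their expectations. The deviation splits into the centred
    truncated sum at level [n], the truncation tail and the bias [j%:R * (mean - mu n)]; each is o(b
    ^ n) uniformly in [j]. *)
Lemma dyadic_max_bound (R : realType) (b th C : R) (x : nat -> R)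
    (y : nat -> nat -> R) (mu : nat -> R) (mean : R) (s : R^nat) :
  1 < b -> 0 < th < 1 ->
  (forall m i, y m i <= y m.+1 i) -> (forall m i, y m i <= x i) ->
  (forall m, mu m <= mu m.+1) -> (forall m, mu m <= mean) ->
  (forall n, 0 <= s n) ->
  (forall n m k, (m <= n)%N -> (k.+1 * 2 ^ m <= 2 ^ n)%N ->
    `|\sum_(i < 2 ^ m) (y m (k * 2 ^ m + i)%N - mu m)| <=
    b ^+ n * th ^+ (n - m) * s n) ->
  (forall N, \sum_(n < N) (2 / b) ^+ n * (mean - mu n) <= C) ->
  s n @[n --> \oo] --> (0 : R) ->
  (\sum_(i < 2 ^ n) (x i - y n i)) / b ^+ n @[n --> \oo] --> (0 : R) ->
  exists2 delta : R^nat, delta n @[n --> \oo] --> (0 : R) &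
    forall n j, (j <= 2 ^ n)%N ->
      `|\sum_(i < j) (x i - mean)| <= b ^+ n * delta n.
Proof.
move=> b1 /andP[th0 th1] ymono yx mumono mumean s0 Hs FC scvg rcvg.
have b0 : 0 < b by lra.
set F := fun n => (2 / b) ^+ n * (mean - mu n).
set r := fun n => (\sum_(i < 2 ^ n) (x i - y n i)) / b ^+ n.
have F0 n : 0 <= F n.
  by rewrite mulr_ge0 ?subr_ge0 ?exprn_ge0 ?divr_ge0// ltW.
(* One term each for the block sums, the bias of the truncated means and the truncation tail. The
   first coefficient is the 4 of [dyadic_prefix_bound] times the geometric sum of the weights
   [th ^+ (n - m)]. *)
exists (fun n => 4 / (1 - th) * s n +
  (2 * \sum_(l < n.+1) (b^-1) ^+ (n - l) * F l) + r n).
  have ccvg : \sum_(l < n.+1) b^-1 ^+ (n - l) * F l @[n --> \oo] --> (0 : R).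
    by apply: (@cvg_conv_geom _ _ F C) => //; rewrite invr_ge0 ltW//= invf_lt1.
  rewrite -[X in _ --> X](_ : 4 / (1 - th) * 0 + 2 * 0 + 0 = 0); last first.
    by rewrite !mulr0 !addr0.
  exact: cvgD (cvgD (cvgMl_tmp (a := 4 / (1 - th)) scvg)
    (cvgMl_tmp (a := 2) ccvg)) rcvg.
move=> n j jn.
have bF l : 2 ^+ l * (mean - mu l) = b ^+ l * F l.
  by rewrite /F mulrA -exprMn mulrCA divff ?mulr1// gt_eqF.
have bn0 : 0 < b ^+ n by rewrite exprn_gt0.
have main : `|\sum_(i < j) (y n i - mu n)| <=
    b ^+ n * (4 / (1 - th) * s n) + 2 * \sum_(l < n) b ^+ l * F l.
  have n1 : (1 * 2 ^ n <= 2 ^ n)%N by rewrite mul1n.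
  have := dyadic_prefix_bound ymono mumono (Hs n) (leqnn n) n1 jn.
  rewrite (eq_bigr (fun i : 'I_j => y n i - mu n)) //.
  move=> /le_trans; apply; apply: lerD.
    apply: le_trans (_ : 4 * (\sum_(l < n.+1) b ^+ n * th ^+ (n - l) * s n)
      <= _).
      rewrite big_ord_recr/= subnn expr0 mulr1 mulrDr lerD2l.
      have := mulr_ge0 (ltW bn0) (s0 n); lra.
    rewrite -mulr_suml -mulr_sumr [leRHS]mulrCA -!mulrA ler_wpM2l//.
    rewrite !mulrA ler_wpM2r// [leRHS]mulrC ler_wpM2l ?(ltW bn0)//.
    rewrite (reindex_inj rev_ord_inj)/=.
    rewrite (eq_bigr (fun i : 'I_n.+1 => th ^+ i)).
      by rewrite sum_geom_le// th1 ltW.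
    by move=> i _; rewrite subSS subKn// -ltnS.
  (* The increment [mu l.+1 - mu l] is at most [mean - mu l]; the factor 2 comes from
     [2 ^+ l.+1]. *)
  rewrite mulr_sumr; apply: ler_sum => l _.
  rewrite -bF exprS -mulrA ler_wpM2l// ler_wpM2l ?exprn_ge0//.
  by rewrite lerD2r.
have tail : 0 <= \sum_(i < j) (x i - y n i) <= b ^+ n * r n.
  rewrite sumr_ge0/=; last by move=> i _; rewrite subr_ge0.
  rewrite /r mulrC divfK ?gt_eqF// -(subnKC jn) big_split_ord/= lerDl.
  by rewrite sumr_ge0// => i _; rewrite subr_ge0.
have bias : 0 <= j%:R * (mean - mu n) <= b ^+ n * F n.
  rewrite -bF mulr_ge0 ?subr_ge0//= ler_wpM2r ?subr_ge0// -natrX ler_nat//.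
have E : \sum_(i < j) (x i - mean) = \sum_(i < j) (y n i - mu n)
    + \sum_(i < j) (x i - y n i) - j%:R * (mean - mu n).
  have -> : j%:R * (mean - mu n) = \sum_(i < j) (mean - mu n).
    by rewrite sumr_const card_ord -[RHS]mulr_natl.
  by rewrite -big_split/= -sumrB; apply: eq_bigr => i _; ring.
have conv : b ^+ n * \sum_(l < n.+1) b^-1 ^+ (n - l) * F l =
    (\sum_(l < n) b ^+ l * F l) + b ^+ n * F n.
  rewrite mulr_sumr big_ord_recr/= subnn expr0 mul1r; congr (_ + _).
  apply: eq_bigr => l _; rewrite mulrA; congr (_ * _).
  have ln : (l <= n)%N by apply: ltnW.
  by rewrite -{1}(subnKC ln) exprD -mulrA -exprMn divff ?gt_eqF// expr1n mulr1.
have bF0 : 0 <= b ^+ n * F n by rewrite mulr_ge0// ltW.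
rewrite E !mulrDr [b ^+ n * (2 * _)]mulrCA conv.
move: main tail bias; rewrite !ler_norml => /andP[? ?] /andP[? ?] /andP[? ?].
by apply/andP; split; lra.
Qed.

(** For 2 ^ n <= j < 2 ^ (n + 1) the bound is applied at [n.+1], and b ^ n, being 2 ^ n to the power
    1 / p, is at most j to the power 1 / p. The shift by one level costs a factor [b], hence the
    tolerance [e / b]. *)
Lemma dyadic_max_bound_cvg (R : realType) (b p : R) (S : nat -> R)
    (delta : R^nat) :
  1 < b -> 0 < p -> b `^ p = 2 -> delta n @[n --> \oo] --> (0 : R) ->
  (forall n j, (j <= 2 ^ n)%N -> `|S j| <= b ^+ n * delta n) ->
  S n / n%:R `^ p^-1 @[n --> \oo] --> (0 : R).
Proof.
move=> b1 p0 bp /cvgrPdist_lt dcvg HS; have b0 : 0 < b by lra.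
apply/cvgrPdist_lt => e e0.
have eb : 0 < e / b by rewrite divr_gt0.
have [N _ HN] := dcvg _ eb.
exists (2 ^ N)%N => // j /= Nj; rewrite sub0r normrN.
have j0 : (0 < j)%N by rewrite (leq_trans _ Nj)// expn_gt0.
have /andP[lo hi] := @trunc_log_bounds 2 j isT j0.
set n := trunc_log 2 j in lo hi.
have Nn : (N <= n)%N.
  by rewrite -ltnS -(@ltn_exp2l 2)//; apply: leq_ltn_trans hi.
have := HN n.+1 (leq_trans Nn (leqnSn n)); rewrite /= sub0r normrN => dn.
have jp : b ^+ n <= j%:R `^ p^-1.
  have -> : b ^+ n = (2 ^ n)%:R `^ p^-1.
    have -> : (2 ^ n)%:R = (b ^+ n) `^ p :> R.
      by rewrite natrX -(powR_mulrn n (ltW b0)) powRAC bp powR_mulrn.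
    by rewrite -powRrM divff ?gt_eqF// powRr1// exprn_ge0// ltW.
  by rewrite ge0_ler_powR ?nnegrE// ?invr_ge0 ?(ltW p0)// ler_nat.
have bn0 : 0 < b ^+ n by rewrite exprn_gt0.
have jp0 : 0 < j%:R `^ p^-1 by apply: lt_le_trans jp.
rewrite normrM normfV (gtr0_norm jp0) ltr_pdivrMr//.
apply: (le_lt_trans (HS n.+1 j (ltnW hi))).
apply: le_lt_trans (_ : b ^+ n.+1 * `|delta n.+1| < _).
  by rewrite ler_wpM2l ?exprn_ge0 ?(ltW b0)// ler_norm.
apply: lt_le_trans (_ : b ^+ n.+1 * (e / b) <= _).
  by rewrite ltr_pM2l ?exprn_gt0.
have -> : b ^+ n.+1 * (e / b) = e * b ^+ n.
  by rewrite exprSr mulrCA mulfK// gt_eqF.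
by rewrite ler_wpM2l// ltW.
Qed.

(** * Summability in mean and integrability tools *)

(** By monotone convergence the sum of the series has integral at most [C], so it is finite almost
    everywhere and its terms vanish in the limit. *)
Lemma ae_cvg0_of_summable (d : measure_display) (T : measurableType d)
    (R : realType) (mu : {measure set T -> \bar R}) (h : nat -> T -> R)
    (C : R) :
  (forall n, mu.-integrable setT (EFin \o h n)) -> (forall n x, 0 <= h n x) ->
  (forall N, \sum_(n < N) \int[mu]_x h n x <= C) ->
  {ae mu, forall x, h n x @[n --> \oo] --> (0 : R)}.
Proof.
move=> inth h0 hC.
have mh n : measurable_fun setT (EFin \o h n) by case/integrableP: (inth n).
have h0' n x : setT x -> (0 <= (EFin \o h n) x)%E by rewrite lee_fin h0.
set G := fun x => (\sum_(n <oo) (h n x)%:E)%E.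
have G0 x : (0 <= G x)%E by apply: nneseries_ge0 => n _ _; rewrite lee_fin.
have intG : mu.-integrable setT G.
  apply/integrableP; split.
    apply: ge0_emeasurable_sum => [k x _ _|k _]; last exact: mh.
    by rewrite lee_fin h0.
  under eq_integral do rewrite gee0_abs//.
  rewrite integral_nneseries//.
  apply: (@le_lt_trans _ _ C%:E); last exact: ltry.
  apply: lime_le.
    by apply: is_cvg_nneseries => n _ _; apply: integral_ge0 => x; exact: h0'.
  near=> N; rewrite big_mkord.
  rewrite (eq_bigr (fun n : 'I_N => (\int[mu]_x h n x)%:E)).
    by rewrite sumEFin lee_fin; exact: hC.
  move=> n _; rewrite /Rintegral fineK//.
  exact: integrable_fin_num (inth n).
have := integrable_ae measurableT intG.
apply: filterS => x /(_ I) Gfin.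
apply: (@bounded_partial_sum_cvg0 _ _ (fine (G x))) => // N.
rewrite -lee_fin fineK// -sumEFin -(big_mkord xpredT (fun n => (h n x)%:E)).
by apply: nneseries_lim_ge => n _ _; rewrite lee_fin.
Unshelve. all: by end_near. Qed.

Lemma integrable_sumr (d : measure_display) (T : measurableType d)
    (R : realType) (mu : {measure set T -> \bar R}) (I : Type) (s : seq I)
    (h : I -> T -> R) :
  (forall i, mu.-integrable setT (EFin \o h i)) ->
  mu.-integrable setT (EFin \o (fun x => \sum_(i <- s) h i x)).
Proof.
move=> inth.
rewrite (_ : _ \o _ = fun x => (\sum_(i <- s) (h i x)%:E)%E); last first.
  by apply/funext => x /=; rewrite sumEFin.
by apply: integrable_sum => // i _; exact: inth.
Qed.

Lemma Rintegral_sum (d : measure_display) (T : measurableType d)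
    (R : realType) (mu : {measure set T -> \bar R}) (I : Type) (s : seq I)
    (h : I -> T -> R) :
  (forall i, mu.-integrable setT (EFin \o h i)) ->
  \int[mu]_x (\sum_(i <- s) h i x) = \sum_(i <- s) \int[mu]_x h i x.
Proof.
move=> inth; elim: s => [|i s IH].
  rewrite big_nil -[RHS](_ : \int[mu]_x 0 = 0).
    by apply: eq_Rintegral => x _; rewrite big_nil.
  by rewrite Rintegral_cst// mul0r.
rewrite big_cons -IH -RintegralD//; last exact: integrable_sumr.
by apply: eq_Rintegral => x _; rewrite big_cons.
Qed.

Lemma integrable_bounded (d : measure_display) (T : measurableType d)
    (R : realType) (P : probability T R) (f : T -> R) (M : R) :
  measurable_fun setT f -> (forall x, `|f x| <= M) ->
  P.-integrable setT (EFin \o f).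
Proof.
move=> mf fM; apply: measurable_bounded_integrable => //.
  exact: le_lt_trans (probability_le1 P measurableT) (ltry 1).
exists M; split; first exact: num_real.
by move=> y My x _; apply: (le_trans (fM x)); exact: ltW.
Qed.

Lemma le_integrable_real (d : measure_display) (T : measurableType d)
    (R : realType) (mu : {measure set T -> \bar R}) (f g : T -> R) :
  measurable_fun setT f -> (forall x, `|f x| <= g x) ->
  mu.-integrable setT (EFin \o g) -> mu.-integrable setT (EFin \o f).
Proof.
move=> mf fg; apply: le_integrable => //; first exact/measurable_EFinP.
by move=> x _ /=; rewrite lee_fin (le_trans (fg x))// ler_norm.
Qed.

(** * Equality of laws, independence and block variances *)

(** Using extended integrals of nonnegative functions lets this transfer integrability as well as
    means. *)
Lemma eq_distribution_Rintegral (d : measure_display) (T : measurableType d)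
    (R : realType) (P : probability T R) (X Y : {RV P >-> R}) (f : R -> R) :
  (forall A, measurable A -> distribution P X A = distribution P Y A) ->
  measurable_fun setT f -> (forall x, 0 <= f x) ->
  (\int[P]_w (f (X w))%:E = \int[P]_w (f (Y w))%:E)%E.
Proof.
move=> XY mf f0.
have mf' : measurable_fun setT (EFin \o f) by exact/measurable_EFinP.
have f0' y : (0 <= (EFin \o f) y)%E by rewrite lee_fin.
rewrite -(ge0_integral_distribution X mf' f0').
rewrite -(ge0_integral_distribution Y mf' f0').
by apply: eq_measure_integral => A mA _; exact: XY.
Qed.

(** Independence says that the law of the pair agrees with the product of the marginal laws on
    rectangles, hence on all measurable sets; the product formula is then Fubini. Boundedness
    supplies all the integrability. *)
Lemma independent_RintegralM (d : measure_display) (T : measurableType d)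
    (R : realType) (P : probability T R) (X Y : {RV P >-> R}) (f g : R -> R)
    (M : R) :
  independent_rv X Y -> measurable_fun setT f -> measurable_fun setT g ->
  (forall x, `|f x| <= M) -> (forall x, `|g x| <= M) ->
  \int[P]_w (f (X w) * g (Y w)) = \int[P]_w f (X w) * \int[P]_w g (Y w).
Proof.
move=> XY mf mg fM gM.
have mXY : measurable_fun setT (fun w => (X w, Y w)).
  by apply: measurable_fun_pair.
pose XYm := isMeasurableFun.Build _ _ _ _ _ mXY.
pose Z : {mfun T >-> (R * R)%type} :=
  MeasurableFun.Pack (MeasurableFun.Class XYm).
pose h (z : R * R) : R := f z.1 * g z.2.
have mh : measurable_fun setT h.
  by apply: measurable_funM; apply: measurableT_comp.
have mh' : measurable_fun setT (EFin \o h) by exact/measurable_EFinP.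
have M0 : 0 <= M by apply: le_trans (fM 0).
have hM z : `|h z| <= M * M by rewrite normrM ler_pM.
have ihZ : P.-integrable setT ((EFin \o h) \o Z).
  apply: (@integrable_bounded _ _ _ _ (h \o Z) (M * M)) => [|w].
    exact: measurableT_comp.
  exact: hM.
have ZE A : measurable A -> (distribution P X \x distribution P Y)%E A =
    distribution P Z A.
  apply: product_measure_unique => A1 A2 mA1 mA2 /=.
  by rewrite -XY.
have ihp : (distribution P X \x distribution P Y)%E.-integrable setT
    (EFin \o h).
  apply/integrableP; split => //.
  rewrite (eq_measure_integral (distribution P Z)); last first.
    by move=> A mA _; exact: ZE.
  have : (distribution P Z).-integrable setT (EFin \o h).
    exact: (integrable_pushforward mXY mh' ihZ measurableT).
  by case/integrableP.
have intgY : P.-integrable setT (EFin \o (fun w => g (Y w))).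
  by apply: (@integrable_bounded _ _ _ _ _ M) => //; exact: measurableT_comp.
have intfX : P.-integrable setT (EFin \o (fun w => f (X w))).
  by apply: (@integrable_bounded _ _ _ _ _ M) => //; exact: measurableT_comp.
have E : (\int[P]_w (h (Z w))%:E =
    \int[P]_w (f (X w) * \int[P]_w g (Y w))%:E)%E.
  rewrite -(@integral_distribution _ _ _ _ _ _ Z _ mh' ihZ).
  rewrite -(eq_measure_integral (distribution P Z) (fun A mA _ => ZE A mA)).
  rewrite -integral12_prod_meas1//.
  set c := (\int[P]_w g (Y w))%R.
  have -> : (\int[P]_w (f (X w) * c)%:E =
      \int[distribution P X]_x (f x * c)%:E)%E.
    rewrite integral_distribution//.
      by apply/measurable_EFinP; apply: measurable_funM.
    apply: (@integrable_bounded _ _ _ _ _ (M * `|c|)).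
      by apply: measurable_funM => //; exact: measurableT_comp.
    by move=> w; rewrite normrM ler_wpM2r.
  apply: eq_integral => x _; rewrite /fubini_F.
  have mgx : measurable_fun setT (fun y => (f x * g y)%:E).
    by apply/measurable_EFinP; apply: measurable_funM.
  have intx : P.-integrable setT (EFin \o (fun w => f x * g (Y w))).
    apply: (@integrable_bounded _ _ _ _ _ (M * M)) => [|w].
      by apply: measurable_funM => //; exact: measurableT_comp.
    exact: (hM (x, Y w)).
  rewrite (integral_distribution mgx intx) /c -RintegralZl// /Rintegral fineK//.
  exact: integrable_fin_num intx.
by rewrite -RintegralZr// /Rintegral -E.
Qed.

Lemma identically_distributed_Rintegral (d : measure_display)
    (T : measurableType d) (R : realType) (P : probability T R)
    (X : nat -> {RV P >-> R}) (f : R -> R) (i : nat) :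
  identically_distributed X -> measurable_fun setT f -> (forall x, 0 <= f x) ->
  \int[P]_w f (X i w) = \int[P]_w f (X 0%N w).
Proof.
move=> Xid mf f0; congr fine.
by apply: eq_distribution_Rintegral => // A mA; exact: Xid.
Qed.

(** When the square is expanded, pairwise independence kills the off-diagonal terms, and each
    diagonal term is a variance, at most the second moment. The offset [s] is the start of the
    block. *)
Lemma block_variance_le (d : measure_display) (T : measurableType d)
    (R : realType) (P : probability T R) (X : nat -> {RV P >-> R})
    (g : R -> R) (M : R) (s n : nat) :
  pairwise_independent X -> identically_distributed X ->
  measurable_fun setT g -> (forall x, 0 <= g x <= M) ->
  \int[P]_w ((\sum_(i < n) (g (X (s + i)%N w) - \int[P]_w g (X 0%N w))) ^+ 2)
  <= n%:R * \int[P]_w (g (X 0%N w) ^+ 2).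
Proof.
move=> Xindep Xid mg gM; set c := \int[P]_w g (X 0%N w).
have g0 x : 0 <= g x by case/andP: (gM x).
have M0 : 0 <= M by case/andP: (gM 0) => /le_trans; apply.
pose z x := g x - c.
have mz : measurable_fun setT z by apply: measurable_funB.
have zM x : `|z x| <= M + `|c|.
  rewrite (le_trans (ler_normB _ _))// lerD2r ger0_norm//.
  by case/andP: (gM x).
have K0 : 0 <= M + `|c| by rewrite addr_ge0.
have intg i : P.-integrable setT (EFin \o (fun w => g (X i w))).
  apply: (@integrable_bounded _ _ _ _ _ M) => [|w].
    exact: measurableT_comp.
  by rewrite ger0_norm//; case/andP: (gM (X i w)).
have intg2 i : P.-integrable setT (EFin \o (fun w => g (X i w) ^+ 2)).
  apply: (@integrable_bounded _ _ _ _ _ (M ^+ 2)) => [|w].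
    by apply: measurable_funX; exact: measurableT_comp.
  rewrite ger0_norm ?sqr_ge0//; case/andP: (gM (X i w)) => ? ?.
  by rewrite lerXn2r ?nnegrE.
have intz i j : P.-integrable setT (EFin \o (fun w => z (X i w) * z (X j w))).
  apply: (@integrable_bounded _ _ _ _ _ ((M + `|c|) * (M + `|c|))) => [|w].
    by apply: measurable_funM; exact: measurableT_comp.
  by rewrite normrM ler_pM.
have intc (r : R) : P.-integrable setT (EFin \o (fun=> r)).
  by apply: (@integrable_bounded _ _ _ _ _ `|r|).
have Ec (r : R) : \int[P]_w r = r.
  rewrite Rintegral_cst// -[RHS]mulr1; congr (_ * _).
  by have /= -> := @probability_setT _ _ _ P.
have Ez i : \int[P]_w z (X i w) = 0.
  rewrite RintegralB// Ec.
  by rewrite (identically_distributed_Rintegral i Xid mg g0) subrr.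
have Ezz i j : i != j -> \int[P]_w (z (X i w) * z (X j w)) = 0.
  move=> ij; rewrite (independent_RintegralM (Xindep _ _ ij) mz mz zM zM).
  by rewrite Ez mul0r.
have Ez2 i : \int[P]_w (z (X i w) * z (X i w)) <= \int[P]_w (g (X 0%N w) ^+ 2).
  have -> : \int[P]_w (z (X i w) * z (X i w)) =
      \int[P]_w (g (X i w) ^+ 2 + (- (2 * c) * g (X i w) + c ^+ 2)).
    by apply: eq_Rintegral => w _; rewrite /z; ring.
  have int1 : P.-integrable setT (EFin \o (fun w => - (2 * c) * g (X i w))).
    rewrite (_ : _ \o _ = fun w => ((- (2 * c))%:E * (g (X i w))%:E)%E)//.
    exact: integrableZl (intg i).
  have int2 : P.-integrable setT
      (EFin \o (fun w => - (2 * c) * g (X i w) + c ^+ 2)).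
    exact: (integrableD measurableT int1 (intc _)).
  rewrite RintegralD// RintegralD// RintegralZl// Ec.
  rewrite (identically_distributed_Rintegral i Xid mg g0) -/c.
  have mg2 : measurable_fun setT (fun x => g x ^+ 2) by exact: measurable_funX.
  have g20 x : 0 <= g x ^+ 2 by exact: sqr_ge0.
  rewrite (identically_distributed_Rintegral i Xid mg2 g20).
  by have := sqr_ge0 c; lra.
have -> : \int[P]_w ((\sum_(i < n) (g (X (s + i)%N w) - c)) ^+ 2) =
    \sum_(i < n) \sum_(j < n)
      \int[P]_w (z (X (s + i)%N w) * z (X (s + j)%N w)).
  transitivity (\sum_(i < n) \int[P]_w (\sum_(j < n)
      z (X (s + i)%N w) * z (X (s + j)%N w))); last first.
    by apply: eq_bigr => i _; rewrite Rintegral_sum// => j; exact: intz.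
  rewrite -Rintegral_sum; last first.
    by move=> i; apply: integrable_sumr => j; exact: intz.
  apply: eq_Rintegral => w _; rewrite expr2 mulr_suml.
  by apply: eq_bigr => i _; rewrite mulr_sumr.
rewrite -[in leRHS](card_ord n) [leRHS]mulr_natl -sumr_const.
apply: ler_sum => i _.
rewrite (bigD1 i)//= big1 ?addr0// => j ji.
by apply: Ezz; rewrite eqn_add2l eq_sym.
Qed.

(** * The law for nonnegative functions of the variables *)

(** Both ends of the range of [p] enter: p > 1 gives b < 2, so that the excess series has weights of
    ratio 2 / b > 1, and p < 2 gives b ^ 2 > 2, so that the second moment series has weights of
    ratio 2 / b ^ 2 < 1. *)
Lemma dyadic_base (R : realType) (p : R) : 1 < p -> p < 2 ->
  [/\ 1 < 2 `^ p^-1 :> R, 2 `^ p^-1 < 2 :> R, 2 < (2 `^ p^-1) ^+ 2 :> R &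
      (2 `^ p^-1) `^ p = 2 :> R].
Proof.
move=> p1 p2; have p0 : 0 < p by lra.
have gt1 (r : R) : 0 < r -> 1 < 2 `^ r :> R.
  move=> r0; have := gt0_ltr_powR r0 (x := 1) (y := 2).
  by rewrite powR1 !nnegrE ler01 ler0n ltr1n; exact.
have two0 (r : R) : (r == 0) ==> (2 != 0 :> R).
  by apply/implyP => _; rewrite pnatr_eq0.
have b0 : 0 < 2 `^ p^-1 :> R by rewrite powR_gt0.
have pV1 : p^-1 < 1 by rewrite invf_lt1.
have pV2 : 1 < p^-1 * 2 by rewrite mulrC ltr_pdivlMr// mul1r.
split.
- by apply: gt1; rewrite invr_gt0.
- have E : 2 = 2 `^ p^-1 * 2 `^ (1 - p^-1) :> R.
    by rewrite -powRD// subrKC powRr1.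
  by rewrite [ltRHS]E ltr_pMr// gt1// subr_gt0.
- rewrite -powR_mulrn ?powR_ge0// -powRrM.
  have -> : p^-1 * 2 = 1 + (p^-1 * 2 - 1) by ring.
  rewrite powRD// powRr1// ltr_pMr// gt1// subr_gt0//.
- by rewrite -powRrM mulVf ?gt_eqF// powRr1.
Qed.

(** Working with a function [f] of the given variables allows the hypotheses on [X] to serve
    unchanged for the positive and the negative part. *)
Lemma slln_nonneg_transform (R : realType) (d : measure_display)
    (T : measurableType d) (P : probability T R) (X : nat -> {RV P >-> R})
    (p : R) (f : R -> R) :
  pairwise_independent X -> identically_distributed X ->
  1 < p -> p < 2 -> ('E_P[(fun w => `|X 0%N w| `^ p)%R] < +oo)%E ->
  measurable_fun setT f -> (forall x, 0 <= f x <= `|x|) ->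
  (forall i, P.-integrable setT (EFin \o (fun w => f (X i w)))) /\
  {ae P, forall w : T,
    (\sum_(k < n) (f (X k w) - \int[P]_w f (X 0%N w))) / n%:R `^ p^-1
      @[n --> \oo] --> (0 : R)}.
Proof.
move=> Xindep Xid p1 p2; rewrite expectation.unlock => Xp mf fx.
have [b1 b2 bb bp] := dyadic_base p1 p2; set b := 2 `^ p^-1 in b1 b2 bb bp.
have p0 : 0 < p by lra.
have b0 : 0 < b by lra.
have bn0 n : 0 < b ^+ n by rewrite exprn_gt0.
have f0 x : 0 <= f x by case/andP: (fx x).
(* The common majorant from the two truncation series; the moment hypothesis enters [sumV] and
   [sumF] through its finite mean [K]. *)
pose S w := 1 + 2 * `|X 0%N w| `^ p.
have mXp : measurable_fun setT (fun w => `|X 0%N w| `^ p).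
  apply: (measurableT_comp (measurable_powR p)).
  exact: measurableT_comp.
have intXp : P.-integrable setT (EFin \o (fun w => `|X 0%N w| `^ p)).
  apply/integrableP; split; first exact/measurable_EFinP.
  apply: le_lt_trans Xp.
  apply: ge0_le_integral => //.
  - by apply: measurableT_comp => //; exact/measurable_EFinP.
  - exact/measurable_EFinP.
  - by move=> x _ /=; rewrite lee_fin ger0_norm// powR_ge0.
have intc (r : R) : P.-integrable setT (EFin \o (fun=> r)).
  by apply: (@integrable_bounded _ _ _ _ _ `|r|).
have intS : P.-integrable setT (EFin \o S).
  exact: (integrableD measurableT (intc 1) (integrableZl measurableT 2 intXp)).
pose t m x := Num.min (f x) (b ^+ m).
have mt m : measurable_fun setT (t m) by apply: measurable_minr.
have t0 m x : 0 <= t m x by rewrite le_min f0 ltW.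
have tb m x : t m x <= b ^+ m by rewrite ge_min lexx orbT.
have tf m x : t m x <= f x by rewrite ge_min lexx.
have tS m x : t m x <= t m.+1 x.
  rewrite le_min tf/= (le_trans (tb m x))// exprS ler_peMl//; exact: ltW.
have SE w : f (X 0%N w) `^ p <= `|X 0%N w| `^ p.
  by apply: ge0_ler_powR; rewrite ?nnegrE//; case/andP: (fx (X 0%N w)); lra.
have intf0 : P.-integrable setT (EFin \o (fun w => f (X 0%N w))).
  apply: (le_integrable_real _ _ intS) => [|w]; first exact: measurableT_comp.
  rewrite ger0_norm//; have [_ fXle] := andP (fx (X 0%N w)).
  apply: (le_trans fXle); rewrite /S.
  have Xp0 := powR_ge0 `|X 0%N w| p.
  have [X1|X1] := leP `|X 0%N w| 1; first lra.
  have : `|X 0%N w| <= `|X 0%N w| `^ p.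
    by rewrite -[leLHS]powRr1// ler_powR// ltW.
  lra.
have intt m i : P.-integrable setT (EFin \o (fun w => t m (X i w))).
  apply: (@integrable_bounded _ _ _ _ _ (b ^+ m)) => [|w].
    exact: measurableT_comp.
  by rewrite ger0_norm.
have intt2 m i : P.-integrable setT (EFin \o (fun w => t m (X i w) ^+ 2)).
  apply: (@integrable_bounded _ _ _ _ _ (b ^+ m ^+ 2)) => [|w].
    by apply: measurable_funX; exact: measurableT_comp.
  by rewrite ger0_norm ?sqr_ge0// lerXn2r// nnegrE// ltW.
pose mu m := \int[P]_w t m (X 0%N w).
pose mean := \int[P]_w f (X 0%N w).
have mumono m : mu m <= mu m.+1 by apply: le_Rintegral => // w _; exact: tS.
have mumean m : mu m <= mean by apply: le_Rintegral => // w _; exact: tf.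
pose q := 2 / b ^+ 2.
have q0 : 0 < q by rewrite divr_gt0.
have q1 : q < 1 by rewrite ltr_pdivrMr// mul1r.
pose th := (1 + q) / 2.
have th0 : 0 < th by rewrite /th; lra.
have th1 : th < 1 by rewrite /th; lra.
(* Since [th] is the midpoint of q and 1, th ^ 2 - q = ((1 - q) / 2) ^ 2 > 0. *)
have qth : 0 <= q / th ^+ 2 < 1.
  rewrite divr_ge0 ?sqr_ge0 ?(ltW q0)//= ltr_pdivrMr ?exprn_gt0// mul1r.
  have : 0 < (1 - q) ^+ 2 by rewrite exprn_gt0// subr_gt0.
  by rewrite /th; lra.
pose K := \int[P]_w S w.
pose V m := \int[P]_w (t m (X 0%N w) ^+ 2).
have V0 m : 0 <= V m by apply: Rintegral_ge0 => w _; exact: sqr_ge0.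
have intqV m : P.-integrable setT
    (EFin \o (fun w => q ^+ m * t m (X 0%N w) ^+ 2)).
  exact: (integrableZl measurableT (q ^+ m) (intt2 m 0%N)).
have sumV N : \sum_(m < N) q ^+ m * V m <= (1 + (1 - q)^-1) * K.
  rewrite -[leRHS]RintegralZl//.
  rewrite (eq_bigr (fun m : 'I_N =>
      \int[P]_w (q ^+ m * t m (X 0%N w) ^+ 2))); last first.
    by move=> m _; rewrite RintegralZl.
  rewrite -Rintegral_sum//.
  apply: le_Rintegral => //; first exact: integrable_sumr.
    exact: (integrableZl measurableT _ intS).
  move=> w _; apply: (le_trans (sum_trunc_sq_le N b1 bb p0 bp (f0 _))).
  rewrite ler_wpM2l//; last by have := SE w; rewrite /S; lra.
  by rewrite addr_ge0// invr_ge0 subr_ge0 ltW.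
have intf i : P.-integrable setT (EFin \o (fun w => f (X i w))).
  apply/integrableP; split.
    by apply/measurable_EFinP; exact: measurableT_comp.
  have -> : (\int[P]_w `|(EFin \o (fun w => f (X i w))) w| =
      \int[P]_w (f (X i w))%:E)%E.
    by apply: eq_integral => w _; rewrite gee0_abs//= lee_fin.
  rewrite (eq_distribution_Rintegral (Y := X 0%N))//.
    by rewrite ltey_eq (integrable_fin_num measurableT intf0).
  by move=> A mA; exact: Xid.
split => //.
have intE n i : P.-integrable setT
    (EFin \o (fun w => f (X i w) - t n (X i w))).
  exact: (integrableB measurableT (intf i) (intt n i)).
have EE n i : \int[P]_w (f (X i w) - t n (X i w)) = mean - mu n.
  rewrite RintegralB//; congr (_ - _).
    exact: (identically_distributed_Rintegral i Xid mf f0).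
  exact: (identically_distributed_Rintegral i Xid (mt n) (t0 n)).
have sumF N : \sum_(n < N) (2 / b) ^+ n * (mean - mu n) <= (2 / b - 1)^-1 * K.
  rewrite -[leRHS]RintegralZl//.
  rewrite (eq_bigr (fun n : 'I_N =>
      \int[P]_w ((2 / b) ^+ n * (f (X 0%N w) - t n (X 0%N w))))); last first.
    by move=> n _; rewrite RintegralZl// EE.
  have intFE n : P.-integrable setT
      (EFin \o (fun w => (2 / b) ^+ n * (f (X 0%N w) - t n (X 0%N w)))).
    exact: (integrableZl measurableT _ (intE n 0%N)).
  rewrite -Rintegral_sum//.
  apply: le_Rintegral => //; first exact: integrable_sumr.
    exact: (integrableZl measurableT _ intS).
  move=> w _; apply: (le_trans (sum_trunc_excess_le N b1 b2 p0 bp (f0 _))).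
  rewrite ler_wpM2l//; last by have := SE w; rewrite /S; lra.
  by rewrite invr_ge0 subr_ge0 ler_pdivlMr// mul1r ltW.
pose D m k w := \sum_(i < 2 ^ m) (t m (X (k * 2 ^ m + i)%N w) - mu m).
(* Any th with q < th ^ 2 < 1 would do: th < 1 makes the block bounds
   [b ^+ n * th ^+ (n - m)] summable over m, and q < th ^ 2 keeps the
   weighted sum of squares [W n] summable in mean. *)
pose a n m := (th ^+ 2)^-1 ^+ (n - m) / b ^+ n ^+ 2.
have a0 n m : 0 <= a n m.
  by rewrite divr_ge0// exprn_ge0// ?invr_ge0 ?exprn_ge0// ltW.
(* All blocks of levels [m <= n] among the first 2 ^ n indices; level [m] has 2 ^ (n - m) of
   them. *)
pose W n w := \sum_(m < n.+1) \sum_(k < 2 ^ (n - m)) a n m * D m k w ^+ 2.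
have W0 n w : 0 <= W n w.
  by do 2! (apply: sumr_ge0 => ? _); rewrite mulr_ge0// sqr_ge0.
have intD2 m k : P.-integrable setT (EFin \o (fun w => D m k w ^+ 2)).
  have mD : measurable_fun setT (D m k).
    apply: measurable_sum => i /=; apply: measurable_funB => //.
    exact: measurableT_comp.
  apply: (@integrable_bounded _ _ _ _ _
      ((\sum_(i < 2 ^ m) (b ^+ m + `|mu m|)) ^+ 2)) => [|w].
    exact: measurable_funX.
  rewrite normrX lerXn2r ?nnegrE//.
    by apply: sumr_ge0 => i _; rewrite addr_ge0// ltW.
  apply: (le_trans (ler_norm_sum _ _ _)); apply: ler_sum => i _.
  by rewrite (le_trans (ler_normB _ _))// lerD2r ger0_norm.
have intaD2 n m k : P.-integrable setT
    (EFin \o (fun w => a n m * D m k w ^+ 2)).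
  exact: (integrableZl measurableT _ (intD2 m k)).
have intW n : P.-integrable setT (EFin \o W n).
  by do 2! (apply: integrable_sumr => ?).
(* The 2 ^ (n - m) blocks of level [m] contribute at most 2 ^ n * V m in total, and 2 ^ n / b ^ (2
   n) = q ^ n splits as q ^ (n - m) * q ^ m. The result is a geometric convolution, summable in [n]
   by [sum_conv_le]. *)
have EW n : \int[P]_w W n w <=
    \sum_(m < n.+1) (q / th ^+ 2) ^+ (n - m) * (q ^+ m * V m).
  rewrite Rintegral_sum; last by move=> m; apply: integrable_sumr => ?.
  apply: ler_sum => m _; rewrite Rintegral_sum//.
  apply: (@le_trans _ _ (\sum_(k < 2 ^ (n - m)) a n m * (2 ^+ m * V m))).
    apply: ler_sum => k _; rewrite RintegralZl// ler_wpM2l// -natrX.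
    apply: (block_variance_le (M := b ^+ m)) => // x.
    by rewrite t0 tb.
  have mn : (m <= n)%N by rewrite -ltnS.
  have aE : 2 ^+ (n - m) * (a n m * 2 ^+ m) =
      (q / th ^+ 2) ^+ (n - m) * q ^+ m.
    rewrite exprMn /a; set A := (th ^+ 2)^-1 ^+ (n - m).
    have qn : q ^+ (n - m) * q ^+ m = 2 ^+ (n - m) * 2 ^+ m / b ^+ n ^+ 2.
      by rewrite -!exprD subnK// /q exprMn exprVn exprAC.
    by rewrite [RHS]mulrAC qn; ring.
  rewrite sumr_const card_ord -[leLHS]mulr_natl natrX.
  by rewrite [leRHS]mulrA -aE -!mulrA.
have sumW N : \sum_(n < N) \int[P]_w W n w <=
    (1 + (1 - q)^-1) * K / (1 - q / th ^+ 2).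
  apply: (@le_trans _ _ (\sum_(n < N) \sum_(m < n.+1)
      (q / th ^+ 2) ^+ (n - m) * (q ^+ m * V m))).
    by apply: ler_sum => n _; exact: EW.
  apply: (le_trans (@sum_conv_le _ _ (fun m => q ^+ m * V m) _ qth _)).
    by move=> m; rewrite mulr_ge0// exprn_ge0// ltW.
  rewrite ler_wpM2r//.
  by rewrite invr_ge0 subr_ge0; case/andP: qth => _ /ltW.
pose r n w := (\sum_(i < 2 ^ n) (f (X i w) - t n (X i w))) / b ^+ n.
have r0 n w : 0 <= r n w.
  by rewrite divr_ge0 ?(ltW (bn0 n))// sumr_ge0// => i _; rewrite subr_ge0.
have rE n : r n = fun w =>
    (b ^+ n)^-1 * \sum_(i < 2 ^ n) (f (X i w) - t n (X i w)).
  by apply/funext => w; rewrite /r mulrC.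
have intEs n : P.-integrable setT
    (EFin \o (fun w => \sum_(i < 2 ^ n) (f (X i w) - t n (X i w)))).
  by apply: integrable_sumr => i; exact: intE.
have intr n : P.-integrable setT (EFin \o r n).
  by rewrite rE; exact: (integrableZl measurableT _ (intEs n)).
have sumr N : \sum_(n < N) \int[P]_w r n w <= (2 / b - 1)^-1 * K.
  apply: le_trans (sumF N); apply: ler_sum => n _; rewrite rE RintegralZl//.
  rewrite Rintegral_sum; last by move=> i; exact: intE.
  under eq_bigr do rewrite EE.
  rewrite sumr_const card_ord -[X in _ * X]mulr_natl natrX mulrA.
  by rewrite [_ * 2 ^+ n]mulrC exprMn exprVn.
have := ae_cvg0_of_summable intr r0 sumr.
have := ae_cvg0_of_summable intW W0 sumW.
apply: filterS2 => w Wcvg rcvg.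
have scvg : Num.sqrt (W n w) @[n --> \oo] --> (0 : R).
  rewrite -(@sqrtr0 R).
  by apply: (cvg_comp _ _ Wcvg); exact: sqrt_continuous.
have [] := @dyadic_max_bound R b th ((2 / b - 1)^-1 * K)
  (fun i => f (X i w)) (fun m i => t m (X i w)) mu mean
  (fun n => Num.sqrt (W n w)) b1 _ _ _ mumono mumean _ _ sumF scvg rcvg.
- by rewrite th0.
- by move=> m i; exact: tS.
- by move=> m i; exact: tf.
- by move=> n; exact: sqrtr_ge0.
- move=> n m k mn kn; rewrite -/(D m k w).
  have km : (k < 2 ^ (n - m))%N.
    by rewrite -(@leq_pmul2r (2 ^ m)) ?expn_gt0// -expnD subnK.
  have mn' : (m < n.+1)%N by [].
  (* A single term of a nonnegative sum. As [c ^+ 2 * a n m = 1], taking square roots yields the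
     block bound with [Num.sqrt (W n w)] in the role of [s n]. *)
  have aDW : a n m * D m k w ^+ 2 <= W n w.
    rewrite /W (bigD1 (Ordinal mn'))//= (bigD1 (Ordinal km))//= -addrA lerDl.
    rewrite addr_ge0// ?sumr_ge0// => i _; last rewrite sumr_ge0// => j _.
      by rewrite mulr_ge0// sqr_ge0.
    by rewrite mulr_ge0// sqr_ge0.
  set c := b ^+ n * th ^+ (n - m).
  have c0 : 0 < c by rewrite mulr_gt0// exprn_gt0.
  have ca : c ^+ 2 * a n m = 1.
    rewrite /c /a exprMn [th ^+ _ ^+ 2]exprAC exprVn.
    by rewrite [_^-1 / _]mulrC mulrACA !divff ?mulr1// gt_eqF ?exprn_gt0.
  apply: (@le_trans _ _ (Num.sqrt (c ^+ 2 * W n w))).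
    rewrite -sqrtr_sqr ler_wsqrtr// -[leLHS]mul1r -ca -mulrA.
    by rewrite ler_wpM2l// sqr_ge0.
  by rewrite sqrtrM ?sqr_ge0// sqrtr_sqr ger0_norm// ltW.
move=> delta dcvg Hd.
apply: (dyadic_max_bound_cvg b1 p0 bp dcvg) => n j jn.
exact: Hd.
Qed.

(** * Reduction to positive and negative parts *)

Theorem theorem1 (R : realType) (d : measure_display) (T : measurableType d)
    (P : probability T R) (X : nat -> {RV P >-> R}) (p : R)
    (Xindep : pairwise_independent X)
    (Xid : identically_distributed X)
    (p_gt1 : 1 < p) (p_lt2 : p < 2)
    (Xp : ('E_P[(fun w => `|X 0%N w| `^ p)%R] < +oo)%E) :
  {ae P, forall w : T,
    (partial_sum X n w - fine 'E_P[partial_sum X n]) / n%:R `^ p^-1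
      @[n --> \oo] --> (0 : R)}.
Proof.
pose fp (x : R) := Num.max x 0; pose fm (x : R) := Num.max (- x) 0.
have mfp : measurable_fun setT fp by apply: measurable_maxr.
have mfm : measurable_fun setT fm by apply: measurable_maxr.
have fpX x : 0 <= fp x <= `|x|.
  by rewrite le_max lexx orbT ge_max ler_norm normr_ge0.
have fmX x : 0 <= fm x <= `|x|.
  by rewrite le_max lexx orbT ge_max -{1}normrN ler_norm normr_ge0.
have fpm x : x = fp x - fm x.
  by rewrite /fp /fm; case: (leP x 0) => x0; case: (leP (- x) 0) => x1; lra.
have [intp cvgp] := slln_nonneg_transform Xindep Xid p_gt1 p_lt2 Xp mfp fpX.
have [intm cvgm] := slln_nonneg_transform Xindep Xid p_gt1 p_lt2 Xp mfm fmX.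
set ep := \int[P]_w fp (X 0%N w) in cvgp.
set em := \int[P]_w fm (X 0%N w) in cvgm.
have intpm k : P.-integrable setT
    (EFin \o (fun w => fp (X k w) - fm (X k w))).
  exact: (integrableB measurableT (intp k) (intm k)).
(* Both parts are integrable, so the expectation is finite and [fine] returns its true value. *)
have ES n : fine 'E_P[partial_sum X n] = \sum_(k < n) (ep - em).
  rewrite expectation.unlock -/(Rintegral _ _ _).
  transitivity (\int[P]_w (\sum_(k < n) (fp (X k w) - fm (X k w)))).
    by apply: eq_Rintegral => w _; apply: eq_bigr => k _; exact: fpm.
  rewrite Rintegral_sum//; apply: eq_bigr => k _; rewrite RintegralB//.
  congr (_ - _); apply: identically_distributed_Rintegral => // x.
    by case/andP: (fpX x).
  by case/andP: (fmX x).
apply: filterS2 cvgp cvgm => w wp wm.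
have E n : (partial_sum X n w - fine 'E_P[partial_sum X n]) / n%:R `^ p^-1 =
    (\sum_(k < n) (fp (X k w) - ep)) / n%:R `^ p^-1 -
    (\sum_(k < n) (fm (X k w) - em)) / n%:R `^ p^-1.
  rewrite ES -mulrBl -!sumrB; congr (_ / _).
  by apply: eq_bigr => k _; rewrite [in LHS](fpm (X k w)); ring.
by rewrite (funext E) -[X in _ --> X](subr0 0); exact: cvgB wp wm.
Qed.
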